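(* Let $G$ be a graph and let $H$ be a maximal subgraph of $G$ without a leaf. (1) If the local multiset dimension of $H$ is finite, then $lmd(G)\le lmd(H)$. (2) $ldim_{ms}(G)\le ldim_{ms}(H)$. Moreover, these bounds are sharp (there exist $G$ and $H$ for which equality holds).
   Context: All graphs (including $G$ and $H$) are finite, connected, undirected and simple; $d(u,v)$ is the distance between $u$ and $v$. A leaf is a vertex of degree one. A subgraph $H\subseteq G$ is called a maximal subgraph with property $P$ if $H$ has property $P$ and $H+e$ does not have property $P$ for any edge $e$ of $G$ (not in $H$); here $P$ is the property of having no leaf. For a graph $F$, a nonempty set $W\subseteq V(F)$ and a vertex $u\in V(F)$, the representation multiset $m(u|W)$ is the multiset of the distances $d(u,w)$ in $F$, $w\in W$. $W$ is a local multiset resolving set of $F$ if $m(u|W)\neq m(v|W)$ for every two adjacent vertices $u,v$ of $F$; the smallest cardinality of such a set is the local multiset dimension $lmd(F)$, which is infinite if no such set exists. $W$ is a local outer multiset resolving set of $F$ if $m(u|W)\neq m(v|W)$ for every two adjacent vertices $u,v$ in $V(F)\setminus W$; the smallest cardinality of such a set is the local outer multiset dimension $ldim_{ms}(F)$.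
   Formalization: Maximality of H is taken to mean that adding any nonempty set of edges of G not in H creates a leaf, not just any single edge; with single edges the claim fails, e.g. for G a 4-cycle and a triangle sharing one vertex and H the 4-cycle. *)

(* Defs.v *)
From mathcomp Require Import all_boot finmap multiset.

Set Implicit Arguments.
Unset Strict Implicit.
Unset Printing Implicit Defensive.

Local Open Scope mset_scope.
Local Open Scope nat_scope.

(* Finite simple graphs whose vertices are drawn from a finite type T; the    *)
(* vertex set may be a proper subset of T, so that a graph and its subgraphs  *)
(* have the same type.                                                        *)
Record sgraph (T : finType) := SGraph {
  verts : {set T};
  edges : {set {set T}};
  edgesP : forall e, e \in edges -> e \subset verts /\ #|e| = 2
}.

Section Graphs.
Variable T : finType.
Implicit Types (F G H : sgraph T) (W : {set T}) (E : {set {set T}}).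

(* Irreflexive, since [set x; x] has cardinal 1.                              *)
Definition adj F : rel T := [rel x y | [set x; y] \in edges F].

Definition connected_graph F : Prop :=
  verts F != set0 /\ {in verts F &, forall x y, connect (adj F) x y}.

(* Least length of a walk from x to y; walks of length #|T| or more are never *)
(* needed, and the value is #|T| when there is no walk.                       *)
Definition dist F (x y : T) : nat :=
  find (fun n => [exists p : n.-tuple T, path (adj F) x p && (last x p == y)])
       (iota 0 #|T|).

Definition degree F (x : T) : nat := #|[set y | adj F x y]|.

Definition has_leaf F : bool := [exists x in verts F, degree F x == 1].

Definition subgraph H G : bool :=
  (verts H \subset verts G) && (edges H \subset edges G).

Lemma add_edges_subproof G H E (sEG : E \subset edges G) e :
  e \in edges H :|: E -> e \subset verts H :|: cover E /\ #|e| = 2.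
Proof.
case/setUP=> [/edgesP[sub card2] | eE]; split=> //.
- exact: subset_trans sub (subsetUl _ _).
- by rewrite subsetU // (bigcup_sup e) ?orbT.
- by case: (edgesP (subsetP sEG e eE)).
Qed.

(* H + E: the endpoints of the new edges are added too.                       *)
Definition add_edges G H E (sEG : E \subset edges G) : sgraph T :=
  SGraph (add_edges_subproof (H := H) sEG).

(* Maximality is with respect to adding any nonempty set of edges. Adding     *)
(* edges one at a time would not be enough: an edge with an endpoint outside  *)
(* H always creates a leaf, so that in a triangle and a 4-cycle sharing one   *)
(* vertex the 4-cycle would be maximal, although both of its dimensions are 1 *)
(* and those of the whole graph are larger.                                   *)
Definition maximal_leafless_subgraph G H : Prop :=
  [/\ subgraph H G, ~~ has_leaf H &
      forall E (sEG : E \subset edges G),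
        E != set0 -> [disjoint E & edges H] -> has_leaf (add_edges H sEG)].

Definition mrep F (u : T) W : {mset nat} :=
  seq_mset [seq dist F u w | w <- enum W].

Definition local_ms_resolving F W : bool :=
  [&& W != set0, W \subset verts F &
      [forall u, forall v, adj F u v ==> (mrep F u W != mrep F v W)]].

Definition local_outer_ms_resolving F W : bool :=
  [&& W != set0, W \subset verts F &
      [forall u in verts F :\: W, forall v in verts F :\: W,
         adj F u v ==> (mrep F u W != mrep F v W)]].

(* None stands for infinity.                                                  *)
Definition lmd F : option nat :=
  if [pick W | local_ms_resolving F W] is Some W0
  then Some #|[arg min_(W < W0 | local_ms_resolving F W) #|W| ]|
  else None.

(* The full vertex set is a valid starting point for the minimum: it is local *)
(* outer multiset resolving as soon as F is nonempty.                         *)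
Definition ldim_ms F : nat :=
  #|[arg min_(W < verts F | local_outer_ms_resolving F W) #|W| ]|.

End Graphs.

Definition finite_dim (a : option nat) : bool := a != None.

Definition le_dim (a b : option nat) : bool :=
  match a, b with
  | _, None => true
  | None, Some _ => false
  | Some m, Some n => m <= n
  end.

(* Main.v *)
Require Import Defs.
From mathcomp Require Import all_boot finmap multiset.

(** The point is that [G] is obtained from [H] by attaching trees, one pendant
    vertex at a time, and that attaching a pendant vertex destroys no
    resolving set of the old graph.

    Why only trees are attached: by maximality every nonempty set [E] of edges
    of [G] outside [H] creates a leaf. That leaf cannot be a vertex of [H],
    where degrees are at least two, so it is a vertex outside [H] lying on
    exactly one edge of [E] ([leaf_outside]). The one exception is an [H]
    reduced to a single vertex, which may itself become a leaf; but an edge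
    set with at most one vertex of degree one contains a nonempty edge set
    without any ([leafless_core]), and that smaller set would contradict
    maximality.

    Taking for [E] all the edges outside [H] gives a vertex [x] outside [H]
    which is pendant in [G], attached to some [y] say. Deleting [x] leaves the
    other distances unchanged ([dist_del_vertex]), while the distance from [x]
    to any other vertex is one more than the distance from [y]
    ([dist_pendant]). Hence, for a nonempty [W] avoiding [x], the multisets of
    [x] and [y] have different sums, and all other pairs of adjacent vertices
    are already adjacent, with the same multisets, in the graph without [x].
    By induction on the number of edges outside [H], every set which is
    resolving for [H], in either sense, is resolving for [G]
    ([resolving_off_extend]).

    Both bounds are attained when [G = H] is a single vertex. *)

Set Implicit Arguments.
Unset Strict Implicit.
Unset Printing Implicit Defensive.

Section Proof.
Variable T : finType.
Implicit Types (F G H : sgraph T) (W S : {set T}) (E : {set {set T}}).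
Implicit Types (u v w x y z : T) (p q : seq T).

(** * Adjacency and distance *)

Definition nbrs E x : {set T} := [set y | [set x; y] \in E].

Lemma adjC F x y : adj F x y = adj F y x.
Proof. by rewrite /adj /= setUC. Qed.

Lemma adj_irr F x : adj F x x = false.
Proof.
apply/negP=> /edgesP[_]; by rewrite setUid cards1.
Qed.

Lemma adj_verts F x y : adj F x y -> x \in verts F.
Proof. by case/edgesP=> /subsetP sub _; apply: sub; rewrite !inE eqxx. Qed.

Lemma dist_le F x y p :
  path (adj F) x p -> last x p = y -> dist F x y <= size p.
Proof.
move=> pathp lastp; have [szp|szp] := ltnP (size p) #|T|; last first.
  by apply: leq_trans szp; rewrite -[leqRHS](size_iota 0) find_size.
rewrite leqNgt; apply/negP=> lt.
have := before_find 0 lt; rewrite nth_iota // add0n => /existsP[].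
by exists (in_tuple p); rewrite /= pathp lastp eqxx.
Qed.

Lemma dist_walk F x y : connect (adj F) x y ->
  exists p, [/\ path (adj F) x p, last x p = y & size p = dist F x y].
Proof.
case/connectP=> p0 /shortenP[p pathp uniqp _] lasty.
set a := fun n : nat =>
  [exists p : n.-tuple T, path (adj F) x p && (last x p == y)].
have hasa : has a (iota 0 #|T|).
  apply/hasP; exists (size p).
    rewrite mem_iota /= add0n.
    by move/card_uniqP: uniqp => /= <-; apply: max_card.
  by apply/existsP; exists (in_tuple p); rewrite /= pathp lasty eqxx.
have := nth_find 0 hasa; rewrite nth_iota; last first.
  by rewrite -[ltnRHS](size_iota 0) -has_find.
case/existsP=> q /andP[pathq /eqP lastq]; exists q.
by split; rewrite ?size_tuple.
Qed.

(** * Deleting a pendant vertex *)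

Lemma del_vertex_subproof G x e :
  e \in [set e in edges G | x \notin e] -> e \subset verts G :\ x /\ #|e| = 2.
Proof.
by rewrite inE => /andP[/edgesP[sub ->] xe]; rewrite subsetD1 sub xe.
Qed.

Definition del_vertex G x : sgraph T := SGraph (@del_vertex_subproof G x).

Lemma adj_del_vertex G x u v :
  adj (del_vertex G x) u v = [&& adj G u v, u != x & v != x].
Proof. by rewrite /adj /= !inE negb_or ![x == _]eq_sym. Qed.

Section Pendant.
Variables (G : sgraph T) (x y : T).
Hypothesis conG : connected_graph G.
Hypothesis pend : forall z, adj G x z = (z == y).

Lemma pendant_neq : y != x.
Proof. by rewrite eq_sym -pend adj_irr. Qed.

(** Retracting [x] to [y] turns a walk into a walk avoiding [x]: the edge
    between [x] and [y] becomes a stationary step, which is dropped. This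
    saves one step as soon as the walk starts at [x]. *)
Lemma retract_walk w p u :
  w != x -> path (adj G) u p -> last u p = w ->
  let u' := if u == x then y else u in
  exists q, [/\ path (adj (del_vertex G x)) u' q, last u' q = w
              & size q + (u == x) <= size p].
Proof.
move=> wx; elim: p u => [|z p IH] u /=.
  by move=> _ ->; rewrite (negPf wx); exists [::].
case/andP=> uz pathp lastp.
have [q [pathq lastq szq]] := IH z pathp lastp.
have [eux|ux] := eqVneq u x.
  move: uz; rewrite eux pend => /eqP ezy.
  move: pathq lastq szq; rewrite ezy (negPf pendant_neq) addn0.
  by exists q; split=> //; rewrite addn1.
have [ezx|zx] := eqVneq z x.
  move: uz; rewrite ezx adjC pend => /eqP euy.
  move: pathq lastq szq; rewrite ezx eqxx -euy => pathq lastq szq.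
  exists q; split=> //; rewrite addn0; apply: leqW.
  exact: leq_trans (leq_addr _ _) szq.
move: pathq lastq szq; rewrite (negPf zx) addn0 => pathq lastq szq.
exists (z :: q); split=> //=; last by rewrite addn0.
by rewrite adj_del_vertex uz ux zx.
Qed.

Lemma walk_del_vertex u p :
  path (adj (del_vertex G x)) u p -> path (adj G) u p.
Proof.
by apply: sub_path => a b; rewrite adj_del_vertex => /and3P[].
Qed.

Lemma pendant_base_verts : y \in verts G.
Proof. by have := pend y; rewrite eqxx adjC => /adj_verts. Qed.

Lemma connected_del_vertex : connected_graph (del_vertex G x).
Proof.
split.
  by apply/set0Pn; exists y; rewrite !inE pendant_neq pendant_base_verts.
move=> u w; rewrite !inE => /andP[ux uG] /andP[wx wG].
have /connectP[p pathp lastp] := conG.2 _ _ uG wG.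
have [q []] := retract_walk wx pathp (esym lastp).
by rewrite (negPf ux) => pathq lastq _; apply/connectP; exists q.
Qed.

Lemma dist_del_vertex u w :
  u \in verts (del_vertex G x) -> w \in verts (del_vertex G x) ->
  dist G u w = dist (del_vertex G x) u w.
Proof.
move=> uG' wG'; apply/eqP; rewrite eqn_leq; apply/andP; split.
  have [p [pathp lastp <-]] := dist_walk (connected_del_vertex.2 _ _ uG' wG').
  exact: dist_le (walk_del_vertex pathp) lastp.
move: uG' wG'; rewrite !inE => /andP[ux uG] /andP[wx wG].
have [p [pathp lastp <-]] := dist_walk (conG.2 _ _ uG wG).
have [q []] := retract_walk wx pathp lastp.
rewrite (negPf ux) addn0 => pathq lastq; apply: leq_trans.
exact: dist_le pathq lastq.
Qed.

Lemma dist_pendant w :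
  w \in verts (del_vertex G x) -> dist G x w = (dist G y w).+1.
Proof.
rewrite !inE => /andP[wx wG]; have yG := pendant_base_verts.
have xy : adj G x y by rewrite pend.
apply/eqP; rewrite eqn_leq; apply/andP; split.
  have [p [pathp lastp <-]] := dist_walk (conG.2 _ _ yG wG).
  by apply: (@dist_le G x w (y :: p)) => //=; rewrite xy.
have [p [pathp lastp <-]] := dist_walk (conG.2 _ _ (adj_verts xy) wG).
have [q []] := retract_walk wx pathp lastp.
rewrite eqxx addn1 => pathq lastq; apply: leq_trans; rewrite ltnS.
exact: dist_le (walk_del_vertex pathq) lastq.
Qed.

Lemma mrep_del_vertex W u :
  W \subset verts (del_vertex G x) -> u \in verts (del_vertex G x) ->
  mrep G u W = mrep (del_vertex G x) u W.
Proof.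
move=> /subsetP sW uG'; congr seq_mset; apply/eq_in_map => w.
by rewrite mem_enum => /sW; apply: dist_del_vertex.
Qed.

(** Each distance from [x] exceeds the one from [y] by one, so the sums of the
    two multisets differ by [#|W|]. *)
Lemma mrep_pendant W :
  W != set0 -> W \subset verts (del_vertex G x) -> mrep G x W != mrep G y W.
Proof.
move=> W0 /subsetP sW; apply/eqP=> /eq_seq_msetP /perm_sumn.
rewrite !sumnE !big_map.
rewrite (eq_big_seq (fun w => dist G y w + 1)); last first.
  by move=> w; rewrite mem_enum => /sW /dist_pendant ->; rewrite addn1.
rewrite big_split /= sum1_size -cardE => /eqP.
by rewrite -[eqbRHS]addn0 eqn_add2l cards_eq0 (negPf W0).
Qed.

End Pendant.

(** * Edges outside a maximal leafless subgraph *)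

Lemma edge_pair F e :
  e \in edges F -> exists x y, [/\ e = [set x; y], x != y & adj F x y].
Proof.
move=> eF; have [_ /eqP/cards2P[x [y [xy def_e]]]] := edgesP eF.
by exists x, y; rewrite /adj /= -def_e.
Qed.

Lemma eq_pair x y z : [set x; z] = [set x; y] -> z = y.
Proof.
move=> eq2; have : z \in [set x; y] by rewrite -eq2 !inE eqxx orbT.
rewrite !inE => /orP[/eqP ezx|/eqP //].
have : y \in [set x; z] by rewrite eq2 !inE eqxx orbT.
by rewrite ezx !inE orbb => /eqP.
Qed.

(** Removing the edge at the unique vertex of degree one only affects the
    degree of its other endpoint [y], so the hypothesis persists with [y] in
    place of [h]; and [y] itself had another edge, so that the process stops
    before all edges are gone. *)
Lemma leafless_core G E h :
  E \subset edges G -> E != set0 ->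
  (forall x, #|nbrs E x| = 1 -> x = h) ->
  exists E', [/\ E' \subset E, E' != set0 & forall x, #|nbrs E' x| != 1].
Proof.
have [n] := ubnP #|E|; elim: n E h => // n IH E h ltn sE E0 leafE.
have [h1|h1] := eqVneq #|nbrs E h| 1; last first.
  exists E; split=> // x; apply/eqP=> x1.
  by move: h1; rewrite -(leafE x x1) x1 eqxx.
have /eqP/cards1P[y def_y] := h1.
have hyE : [set h; y] \in E.
  have : y \in nbrs E h by rewrite def_y inE.
  by rewrite inE.
have yh : y != h.
  apply/eqP=> eyh; have := subsetP sE _ hyE.
  by rewrite -[_ \in _]/(adj G h y) eyh adj_irr.
pose E1 := E :\ [set h; y].
have sE1 : E1 \subset E by apply: subD1set.
have nbrs1 x z : (z \in nbrs E1 x) =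
    [&& z \in nbrs E x, ~~ ((x == h) && (z == y)) & ~~ ((x == y) && (z == h))].
  rewrite !inE andbC; case xz: (_ \in E) => //=.
  rewrite -negb_or; congr negb; apply/eqP/orP.
    move=> eq2; have : x \in [set h; y] by rewrite -eq2 !inE eqxx.
    rewrite !inE => /orP[] /eqP ex; [left|right]; rewrite ex eqxx; apply/eqP.
      by apply: (@eq_pair h); rewrite -eq2 ex.
    by apply: (@eq_pair y); rewrite [RHS]setUC -eq2 ex.
  by case=> /andP[/eqP-> /eqP->] //; rewrite setUC.
have E1_0 : E1 != set0.
  have hy : h \in nbrs E y by rewrite inE setUC.
  have /set0Pn[z] : nbrs E y :\ h != set0.
    apply/eqP=> yh0.
    have : y = h by apply: leafE; rewrite (cardsD1 h) hy yh0 cards0.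
    by move/eqP; rewrite (negPf yh).
  rewrite 2!inE => /andP[zh zy]; apply/set0Pn; exists [set y; z].
  have : z \in nbrs E1 y by rewrite nbrs1 zy (negPf yh) (negPf zh) andbF.
  by rewrite inE.
have [|x x1|E' [sE' E'0 leafE']] := IH E1 y _ (subset_trans sE1 sE) E1_0.
- by move: ltn; rewrite (cardsD1 [set h; y] E) hyE.
- apply/eqP; apply: contraLR (introT eqP x1) => xy.
  have [->|xh] := eqVneq x h.
    suff -> : nbrs E1 h = set0 by rewrite cards0.
    apply/setP=> z; rewrite nbrs1 def_y !inE eqxx.
    by case: eqVneq => // ->; rewrite eq_sym (negPf yh).
  suff -> : nbrs E1 x = nbrs E x.
    by apply: contraNneq xh => /leafE ->.
  by apply/setP=> z; rewrite nbrs1 (negPf xh) (negPf xy) andbT.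
by exists E'; split=> //; apply: subset_trans sE' sE1.
Qed.

(** What the proof retains of maximality. Unlike maximality itself it passes to
    any [G'] between [H] and [G], and it locates the leaf outside [H], which
    the induction needs in order to leave [H] intact. *)
Definition every_addition_has_outer_leaf G H := forall E,
  E \subset edges G :\: edges H -> E != set0 ->
  exists2 x, x \notin verts H & #|nbrs E x| = 1.

Lemma connected_degree_gt0 F x :
  connected_graph F -> edges F != set0 -> x \in verts F -> 0 < degree F x.
Proof.
move=> conF /set0Pn[e /edge_pair[a [b [_ ab abF]]]] xF.
have [z zF zx] : exists2 z, z \in verts F & z != x.
  have [eax|ax] := eqVneq a x; last by exists a; rewrite // (adj_verts abF).
  exists b; last by rewrite -eax eq_sym.
  by move: abF; rewrite adjC => /adj_verts.
have /connectP[[|y p] /= pathp lastp] := conF.2 _ _ xF zF.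
  by rewrite lastp eqxx in zx.
by case/andP: pathp => xy _; apply/card_gt0P; exists y; rewrite inE.
Qed.

Lemma nbrs_outside F x : x \notin verts F -> nbrs (edges F) x = set0.
Proof.
move=> xF; apply/setP=> y; rewrite !inE; apply: contraNF xF; exact: adj_verts.
Qed.

(** The graph [H] has no leaf, so a leaf of [H + E] lies outside [H] or is an
    isolated vertex of [H]. In a connected [H] the latter only happens when
    [H] is a single vertex [h]; if then no vertex other than [h] had degree
    one in [E], [leafless_core] would give a leafless extension of [H]. *)
Lemma leaf_outside G H :
  connected_graph H -> maximal_leafless_subgraph G H ->
  every_addition_has_outer_leaf G H.
Proof.
move=> conH [/andP[sV sE] leafH maxH].
have leafD E : E \subset edges G :\: edges H -> E != set0 ->
    exists2 x, #|nbrs (edges H) x :|: nbrs E x| = 1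
             & x \notin verts H \/ #|nbrs (edges H) x| = 0.
  rewrite subsetD => /andP[sEG disE] E0.
  have /existsP[x /andP[_ /eqP x1]] := maxH E sEG E0 disE.
  have nbrsD : #|nbrs (edges H) x :|: nbrs E x| = 1.
    by rewrite -x1 /degree; apply: eq_card => z; rewrite !inE /adj /= inE.
  exists x => //; have [xH|] := boolP (x \in verts H); [right|by left].
  move: leafH; rewrite negb_exists => /forallP/(_ x).
  rewrite xH /= -[degree H x]/#|nbrs (edges H) x|.
  have := subset_leq_card (subsetUl (nbrs (edges H) x) (nbrs E x)).
  by rewrite nbrsD; case: #|_| => [|[]].
have [H0|H0] := eqVneq (edges H) set0; last first.
  move=> E sED E0; have [x x1 xH] := leafD E sED E0.
  have {}xH : x \notin verts H.
    case: xH => // x0; apply/negP=> /(connected_degree_gt0 conH H0).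
    by rewrite -[degree H x]/#|nbrs (edges H) x| x0.
  by exists x; rewrite // -x1 nbrs_outside // set0U.
have [h hH] := set0Pn _ conH.1.
have vertsH x : x \in verts H -> x = h.
  move=> xH; have /connectP[[|y p] /= pathp lastp //] := conH.2 _ _ hH xH.
  by move: pathp; rewrite /adj /= H0 inE.
have nbrs0 x : nbrs (edges H) x = set0 by apply/setP=> y; rewrite H0 !inE.
move=> E sED E0.
have [/existsP[x /andP[xH /eqP x1]]|noleaf] :=
  boolP [exists x, (x \notin verts H) && (#|nbrs E x| == 1)].
  by exists x.
have sEG : E \subset edges G := subset_trans sED (subsetDl _ _).
have [x x1|E' [sE' E'0 leafE']] := @leafless_core G E h sEG E0.
  apply: vertsH; apply: contraNT noleaf => xH.
  by apply/existsP; exists x; rewrite xH x1 eqxx.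
have [x] := leafD E' (subset_trans sE' sED) E'0.
by rewrite nbrs0 set0U => /eqP; rewrite (negPf (leafE' x)).
Qed.

(** * Resolving sets *)

(** With [S] empty this is the condition for local multiset resolving sets;
    with [S = W], the one for the outer variant. *)
Definition resolving_off F W S :=
  forall u v, u \notin S -> v \notin S -> adj F u v -> mrep F u W != mrep F v W.

Lemma resolving_off_pendant G W S x y :
  connected_graph G -> (forall z, adj G x z = (z == y)) ->
  W != set0 -> W \subset verts (del_vertex G x) ->
  resolving_off (del_vertex G x) W S -> resolving_off G W S.
Proof.
move=> conG pend W0 sW res u v uS vS uv.
have [eux|ux] := eqVneq u x.
  move: uv; rewrite eux pend => /eqP ->; exact: mrep_pendant.
have [evx|vx] := eqVneq v x.
  by move: uv; rewrite evx adjC pend => /eqP ->; rewrite eq_sym;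
    exact: mrep_pendant.
have uv' : adj (del_vertex G x) u v by rewrite adj_del_vertex uv ux.
rewrite !(mrep_del_vertex conG pend) ?res //; last exact: adj_verts uv'.
by move: uv'; rewrite adjC => /adj_verts.
Qed.

Lemma eq_resolving_off F1 F2 W S :
  edges F1 = edges F2 -> resolving_off F1 W S -> resolving_off F2 W S.
Proof.
by case: F1 => V1 E1 e1; case: F2 => V2 E2 e2 /= eqE; case: _ / eqE e2.
Qed.

(** Among all the edges outside [H], some vertex [x] outside [H] lies on just
    one; since no edge of [H] meets [x], it is pendant in [G] and the induction
    applies to [G] without [x]. With no edges outside [H], the graphs have the
    same adjacency and hence the same distances. *)
Lemma resolving_off_extend G H W S :
  connected_graph G -> subgraph H G -> every_addition_has_outer_leaf G H ->
  W != set0 -> W \subset verts H ->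
  resolving_off H W S -> resolving_off G W S.
Proof.
move=> + + + W0 sWH resH.
have [n] := ubnP #|edges G :\: edges H|; elim: n G => // n IH G ltn.
move=> conG /andP[sV sE] out; set E := edges G :\: edges H.
have [E0|E0] := eqVneq E set0.
  apply: eq_resolving_off resH; apply/eqP; rewrite eqEsubset sE /=.
  by rewrite -finset.setD_eq0 -/E E0.
have [x xH x1] := out E (subxx _) E0.
have /eqP/cards1P[y def_y] := x1.
have pend z : adj G x z = (z == y).
  have <- : (z \in nbrs E x) = (z == y) by rewrite def_y inE.
  have := nbrs_outside xH; move/setP/(_ z); rewrite !inE => ->.
  by rewrite /adj.
have sV' : verts H \subset verts (del_vertex G x) by rewrite subsetD1 sV.
apply: (resolving_off_pendant conG pend W0 (subset_trans sWH sV')).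
have sG'G : edges (del_vertex G x) \subset edges G.
  by apply/subsetP=> e; rewrite inE => /andP[].
apply: IH => [|||E' sE'].
- rewrite -ltnS; apply: leq_trans ltn; rewrite ltnS; apply: proper_card.
  apply/properP; split; first exact: setSD.
  have : y \in nbrs E x by rewrite def_y inE.
  rewrite inE => xyE; exists [set x; y] => //.
  by rewrite !inE eqxx !andbF.
- exact: connected_del_vertex conG pend.
- rewrite /subgraph sV' /=; apply/subsetP=> e eH; rewrite inE (subsetP sE) //=.
  by apply: contra xH; apply/subsetP; have [] := edgesP eH.
- by apply: out; exact: subset_trans sE' (setSD _ sG'G).
Qed.

Lemma local_ms_resolvingP F W :
  reflect [/\ W != set0, W \subset verts F & resolving_off F W set0]
          (local_ms_resolving F W).
Proof.
apply: (iffP and3P) => -[W0 sW res]; split=> //.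
  by move=> u v _ _; move/forallP/(_ u)/forallP/(_ v)/implyP: res.
apply/forallP=> u; apply/forallP=> v; apply/implyP; apply: res; by rewrite inE.
Qed.

Lemma local_outer_ms_resolvingP F W :
  reflect [/\ W != set0, W \subset verts F & resolving_off F W W]
          (local_outer_ms_resolving F W).
Proof.
apply: (iffP and3P) => -[W0 sW res]; split=> //.
  move=> u v uW vW uv.
  have vF : v \in verts F by move: uv; rewrite adjC => /adj_verts.
  move/forall_inP/(_ u): res; rewrite inE uW (adj_verts uv).
  move/(_ isT)/forall_inP/(_ v); rewrite inE vW vF.
  by move/(_ isT)/implyP; apply.
apply/forall_inP=> u; rewrite inE => /andP[uW _].
apply/forall_inP=> v; rewrite inE => /andP[vW _].
by apply/implyP; apply: res.
Qed.

Lemma local_outer_ms_resolving_verts F :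
  verts F != set0 -> local_outer_ms_resolving F (verts F).
Proof.
move=> F0; apply/local_outer_ms_resolvingP; split=> // u v uF _ /adj_verts.
by rewrite (negPf uF).
Qed.

(** * Dimensions *)

Lemma le_dim_lmd G H :
  (forall W, local_ms_resolving H W -> local_ms_resolving G W) ->
  le_dim (lmd G) (lmd H).
Proof.
move=> res; rewrite /lmd.
case: (pickP (local_ms_resolving H)) => [W0 W0H|_]; last first.
  by case: pickP.
case: arg_minnP => // W WH _.
case: pickP => [W1 W1G|/(_ W)]; last by rewrite res.
by case: arg_minnP => // W2 _; apply; apply: res.
Qed.

Lemma leq_ldim_ms G H :
  verts G != set0 -> verts H != set0 ->
  (forall W, local_outer_ms_resolving H W -> local_outer_ms_resolving G W) ->
  ldim_ms G <= ldim_ms H.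
Proof.
move=> G0 H0 res; rewrite /ldim_ms.
case: arg_minnP => [|W _ min]; first exact: local_outer_ms_resolving_verts.
case: arg_minnP => [|W' W'H _]; first exact: local_outer_ms_resolving_verts.
exact/min/res.
Qed.

(** * Sharpness *)

Lemma maximal_leafless_refl G :
  ~~ has_leaf G -> maximal_leafless_subgraph G G.
Proof.
move=> leafG; split; rewrite ?/subgraph ?subxx // => E sEG /set0Pn[e eE].
by move=> /disjointFr/(_ eE); rewrite (subsetP sEG).
Qed.

End Proof.

Lemma point_subproof e :
  e \in (set0 : {set {set unit}}) -> e \subset [set: unit] /\ #|e| = 2.
Proof. by rewrite inE. Qed.

Definition point_graph : sgraph unit := SGraph point_subproof.

Lemma adj_point x y : adj point_graph x y = false.
Proof. by rewrite /adj /= inE. Qed.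

Lemma connected_point : connected_graph point_graph.
Proof.
by split=> [|[] [] _ _ //]; apply/set0Pn; exists tt; rewrite inE.
Qed.

Lemma leafless_point : ~~ has_leaf point_graph.
Proof.
apply/existsP=> -[x /andP[_]]; rewrite /degree.
by rewrite eq_card0 // => y; rewrite inE adj_point.
Qed.

Lemma finite_lmd_point : finite_dim (lmd point_graph).
Proof.
have res : local_ms_resolving point_graph setT.
  apply/local_ms_resolvingP; split; rewrite ?connected_point.1 //=.
  by move=> u v _ _; rewrite adj_point.
by rewrite /lmd; case: pickP => // /(_ setT); rewrite res.
Qed.

Theorem theorem13 :
  (forall (T : finType) (G H : sgraph T),
     connected_graph G -> connected_graph H ->
     maximal_leafless_subgraph G H ->
     (finite_dim (lmd H) -> le_dim (lmd G) (lmd H)) /\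
     ldim_ms G <= ldim_ms H)
  /\ (exists (T : finType) (G H : sgraph T),
        [/\ connected_graph G, connected_graph H,
            maximal_leafless_subgraph G H,
            finite_dim (lmd H) & lmd G = lmd H])
  /\ (exists (T : finType) (G H : sgraph T),
        [/\ connected_graph G, connected_graph H,
            maximal_leafless_subgraph G H & ldim_ms G = ldim_ms H]).
Proof.
have maxP := maximal_leafless_refl leafless_point.
split; last first.
  have conP := connected_point; have finP := finite_lmd_point.
  by split; exists unit, point_graph, point_graph.
move=> T G H conG conH maxH; have out := leaf_outside conH maxH.
have [sHG _ _] := maxH; have /andP[sV _] := sHG.
split=> [_|].
  apply: le_dim_lmd => W /local_ms_resolvingP[W0 sW res].
  apply/local_ms_resolvingP; split=> //; first exact: subset_trans sW sV.
  exact: resolving_off_extend sHG out W0 sW res.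
apply: leq_ldim_ms conG.1 conH.1 _ => W /local_outer_ms_resolvingP[W0 sW res].
apply/local_outer_ms_resolvingP; split=> //; first exact: subset_trans sW sV.
exact: resolving_off_extend sHG out W0 sW res.
Qed.
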